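(* Let $k \geq 1$ and $n_1, n_2, \ldots, n_k \geq 1$ be integers and let $X_i$ be an $n_i$-dimensional real normed space for $i=1, \ldots, k$. Then, for any $p \in [1,\infty]$, \[ d_{BM}(X_1 \oplus_p \cdots \oplus_p X_k, \ell^{n_1 + \cdots + n_k}_2) = \left\| \left(d_{BM}(X_1,\ell_2^{n_1}), \ldots, d_{BM}(X_k,\ell_2^{n_k})\right) \right\|_r, \] where $r = \frac{2p}{|p-2|} \in [2,\infty]$ (with the conventions $r = \infty$ when $p=2$ and $r=2$ when $p=\infty$).
   Context: For $p \in [1,\infty]$, $\ell_p^n$ is $\mathbb{R}^n$ with the norm $\|x\|_p = (|x_1|^p + \cdots + |x_n|^p)^{1/p}$, where $\|x\|_\infty = \max\{|x_1|,\ldots,|x_n|\}$. The $\ell_p$-direct sum $X_1 \oplus_p \cdots \oplus_p X_k$ of normed spaces $X_i = (\mathbb{R}^{n_i}, \|\cdot\|_{X_i})$ is $\mathbb{R}^{n_1+\cdots+n_k}$ with the norm $\|x\| = (\|x^1\|_{X_1}^p + \cdots + \|x^k\|_{X_k}^p)^{1/p}$ for $x = (x^1,\ldots,x^k)$, $x^i \in \mathbb{R}^{n_i}$ (for $p=\infty$: $\|x\| = \max_i \|x^i\|_{X_i}$). The Banach--Mazur distance between two real normed spaces $X, Y$ of the same finite dimension is $d_{BM}(X,Y) = \inf \|T\|\,\|T^{-1}\|$, the infimum over all invertible linear operators $T: X \to Y$, with operator norms. *)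

(* Defs.v *)
From HB Require Import structures.
From mathcomp Require Import all_boot all_order all_algebra.
From mathcomp Require Import all_classical all_reals all_analysis.
Set Implicit Arguments.
Unset Strict Implicit.
Unset Printing Implicit Defensive.
Import Order.TTheory GRing.Theory Num.Theory.
Local Open Scope classical_set_scope.
Local Open Scope ring_scope.

(* The type 'rV[R]_n carries a canonical (sup) norm in the library, so the
   norms considered here are explicit functions on it.  Nonnegativity and
   N 0 = 0 follow from the three axioms. *)
Record is_norm (R : realType) (V : lmodType R) (N : V -> R) : Prop := IsNorm {
  is_norm_triangle : forall x y, N (x + y) <= N x + N y ;
  is_norm_homogeneous : forall (a : R) x, N (a *: x) = `|a| * N x ;
  is_norm_definite : forall x, N x = 0 -> x = 0
}.

(* Only meant for 1 <= p. *)
Definition lp_norm (R : realType) (p : \bar R) (n : nat) (x : 'rV[R]_n) : R :=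
  match p with
  | q%:E => (\sum_(i < n) `|x 0 i| `^ q) `^ q^-1
  | +oo%E => \big[Num.max/0]_(i < n) `|x 0 i|
  | -oo%E => 0
  end.

Definition lp_sum (R : realType) (p : \bar R) (k : nat) (n : 'I_k -> nat)
    (N : forall i : 'I_k, 'rV[R]_(n i) -> R)
    (x : 'rV[R]_(\sum_(i < k) n i)%N) : R :=
  lp_norm p (\row_(i < k) N i (submxrow x i)).

(* The real supremum is only meaningful for a bounded T, hence in particular
   for every linear T in finite dimension. *)
Definition op_norm (R : realType) (V W : lmodType R) (N : V -> R) (M : W -> R)
    (T : V -> W) : R :=
  sup [set M (T x) | x in [set x | N x <= 1]].

Definition banach_mazur (R : realType) (V W : lmodType R)
    (N : V -> R) (M : W -> R) : R :=
  inf [set c | exists (T : {linear V -> W}) (S : {linear W -> V}),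
         [/\ cancel T S, cancel S T & c = op_norm N M T * op_norm M N S]].

(* 2p / |p - 2|, with value +oo at p = 2 and value 2 at p = +oo. *)
Definition bm_exponent (R : realType) (p : \bar R) : \bar R :=
  match p with
  | q%:E => if q == 2 then +oo%E else (2 * q / `|q - 2|)%:E
  | +oo%E => 2%:E
  | -oo%E => 0%E
  end.

(* Main.v *)
Require Import Defs.
From HB Require Import structures.
From mathcomp Require Import all_boot all_order all_algebra.
From mathcomp Require Import all_classical all_reals all_analysis.
From mathcomp Require Import ring lra.
Set Implicit Arguments.
Unset Strict Implicit.
Unset Printing Implicit Defensive.
Import Order.TTheory GRing.Theory Num.Theory.
Import numFieldNormedType.Exports.
Local Open Scope classical_set_scope.
Local Open Scope ring_scope.

(* Upper bound: the direct sum of nearly optimal isomorphisms of the summands,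
   suitably rescaled, is estimated by Hoelder's inequality and by the
   monotonicity of l_p norms in p.
   Lower bound: let T map the sum onto l_2 with |T x| <= A N(x) and
   N(x) <= B |T x|.  Since N does not see the signs of the blocks, choosing
   these signs well replaces |T x|^2 by the sum of the |T x_i|^2, where x_i is
   the i-th block of x.  The restriction of T to the i-th block is, up to an
   isometry of its image, an isomorphism of X_i onto l_2^(n_i), and the
   sharpness of Hoelder's inequality recombines the distortions of these
   restrictions. *)

(** * Elementary properties of [lp_norm] for exponents in (0, +oo] *)

Variant gt0_ereal_spec (R : realType) : \bar R -> Prop :=
| Gt0Fin (q : R) of 0 < q : gt0_ereal_spec q%:E
| Gt0Inf : gt0_ereal_spec +oo%E.

Lemma gt0_erealP (R : realType) (p : \bar R) : (0 < p)%E -> gt0_ereal_spec p.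
Proof.
case: p => [q p0||p0]; first by apply: Gt0Fin; rewrite -lte_fin.
  by move=> _; exact: Gt0Inf.
by rewrite ltNge leNye in p0.
Qed.

Lemma lp_norm_ge0 (R : realType) (p : \bar R) (n : nat) (x : 'rV[R]_n) :
  0 <= lp_norm p x.
Proof.
case: p => [q||] //=; first exact: powR_ge0.
by apply: (big_ind (fun y : R => 0 <= y)) => // y z y0 z0; rewrite le_max y0.
Qed.

Lemma ler_lp_norm (R : realType) (p : \bar R) (n : nat) (x y : 'rV[R]_n) :
  (0 < p)%E -> (forall i, `|x 0 i| <= `|y 0 i|) -> lp_norm p x <= lp_norm p y.
Proof.
case/gt0_erealP => [q q0|] xy; last by apply: le_bigmax2 => i _; exact: xy.
apply: ge0_ler_powR; rewrite ?nnegrE ?invr_ge0 ?(ltW q0) //;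
  try by apply: sumr_ge0 => i _; exact: powR_ge0.
by apply: ler_sum => i _; apply: ge0_ler_powR; rewrite ?nnegrE ?(ltW q0).
Qed.

Lemma eq_lp_norm (R : realType) (p : \bar R) (n : nat) (x y : 'rV[R]_n) :
  (0 < p)%E -> (forall i, `|x 0 i| = `|y 0 i|) -> lp_norm p x = lp_norm p y.
Proof.
by move=> p0 xy; apply/eqP; rewrite eq_le !ler_lp_norm // => i; rewrite xy.
Qed.

Lemma lp_normZ (R : realType) (p : \bar R) (n : nat) (a : R) (x : 'rV[R]_n) :
  (0 < p)%E -> lp_norm p (a *: x) = `|a| * lp_norm p x.
Proof.
case/gt0_erealP => [q q0|]; rewrite /lp_norm; last first.
  rewrite (big_morph _ (fun y z => maxr_pMr y z (normr_ge0 a)) (mulr0 _)).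
  by apply: eq_bigr => i _; rewrite mxE normrM.
under eq_bigr => i _ do rewrite mxE normrM powRM //.
rewrite -mulr_sumr powRM ?powR_ge0 //; last first.
  by apply: sumr_ge0 => i _; exact: powR_ge0.
by rewrite -powRrM divff ?gt_eqF // powRr1.
Qed.

Lemma ler_lp_normZ (R : realType) (p : \bar R) (n : nat) (c : R)
    (x y : 'rV[R]_n) : (0 < p)%E -> 0 <= c ->
  (forall i, `|x 0 i| <= c * `|y 0 i|) -> lp_norm p x <= c * lp_norm p y.
Proof.
move=> p0 c0 xy; rewrite -[X in X * _](ger0_norm c0) -(lp_normZ c y p0).
by apply: (ler_lp_norm p0) => i; rewrite mxE normrM (ger0_norm c0).
Qed.

Lemma lp_norm_coord (R : realType) (p : \bar R) (n : nat) (x : 'rV[R]_n) i :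
  (0 < p)%E -> `|x 0 i| <= lp_norm p x.
Proof.
case/gt0_erealP => [q q0|]; last exact: (le_bigmax _ (fun i => `|x 0 i|)).
have -> : `|x 0 i| = (`|x 0 i| `^ q) `^ q^-1.
  by rewrite -powRrM divff ?gt_eqF // powRr1.
apply: ge0_ler_powR; rewrite ?nnegrE ?invr_ge0 ?(ltW q0) ?powR_ge0 //.
  by apply: sumr_ge0 => j _; exact: powR_ge0.
by rewrite (bigD1 i) //= lerDl; apply: sumr_ge0 => j _; exact: powR_ge0.
Qed.

Lemma lp_norm_delta (R : realType) (p : \bar R) (n : nat) (i : 'I_n) :
  (0 < p)%E -> lp_norm p (delta_mx 0 i : 'rV[R]_n) = 1.
Proof.
move=> p0; apply/eqP; rewrite eq_le; apply/andP; split; last first.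
  have := @lp_norm_coord R p n (delta_mx 0 i) i p0.
  by rewrite mxE !eqxx normr1.
case/gt0_erealP: p0 => [q q0|]; rewrite /lp_norm; last first.
  apply/bigmax_leP; split=> // j _.
  by rewrite mxE eqxx /=; case: (j == i); rewrite ?normr1 ?normr0.
rewrite (bigD1 i) //= big1 ?addr0 => [|j ji].
  by rewrite mxE !eqxx normr1 !powR1.
by rewrite mxE (negbTE ji) andbF normr0 powR0 // gt_eqF.
Qed.

Lemma lp_norm2_sqr (R : realType) (n : nat) (x : 'rV[R]_n) :
  lp_norm 2%:E x ^+ 2 = \sum_i x 0 i ^+ 2.
Proof.
have s0 : 0 <= \sum_i x 0 i ^+ 2 by apply: sumr_ge0 => i _; exact: sqr_ge0.
rewrite /=; under eq_bigr => i _ do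
  rewrite (powR_mulrn 2) // real_normK ?num_real //.
by rewrite powR12_sqrt // sqr_sqrtr.
Qed.

Lemma lp_norm_powR (R : realType) (q : R) (n : nat) (x : 'rV[R]_n) :
  0 < q -> lp_norm q%:E x `^ q = \sum_i `|x 0 i| `^ q.
Proof.
move=> q0; rewrite /lp_norm -powRrM mulVf ?gt_eqF // powRr1 //.
by apply: sumr_ge0 => i _; exact: powR_ge0.
Qed.

(** For finite exponents, let S be the l_p norm of x. Each |x_i| is at most S, so the sum of |x_i|^q
    is at most S^(q-p) times the sum of |x_i|^p, that is S^q. *)
Lemma ler_lp_norm_exponent (R : realType) (p q : \bar R) (n : nat)
    (x : 'rV[R]_n) : (0 < p)%E -> (p <= q)%E -> lp_norm q x <= lp_norm p x.
Proof.
move=> p0 pq; have q0 := lt_le_trans p0 pq.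
case/gt0_erealP: q0 pq => [{}q q0 pq|_]; last first.
  apply/bigmax_leP; split=> [|i _]; [exact: lp_norm_ge0|].
  exact: lp_norm_coord.
case/gt0_erealP: p0 pq => [{}p p0|]; last by rewrite leye_eq.
rewrite lee_fin => pq.
have S0 := @lp_norm_ge0 R p%:E n x; set S := lp_norm _ _ in S0 *.
have Sp : S `^ p = \sum_i `|x 0 i| `^ p by exact: lp_norm_powR.
rewrite -[S]powRr1 // -[X in S `^ X](divff (lt0r_neq0 q0)).
rewrite powRrM /=.
apply: ge0_ler_powR; rewrite ?nnegrE ?invr_ge0 ?(ltW q0) ?powR_ge0 //.
  by apply: sumr_ge0 => j _; exact: powR_ge0.
(* This holds at y = 0 as well, because the total exponent q is nonzero. *)
have split0 (y : R) : y `^ q = y `^ p * y `^ (q - p).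
  by rewrite -powRD ?subrKC // gt_eqF.
rewrite split0 Sp mulr_suml; apply: ler_sum => i _.
rewrite split0; apply: ler_wpM2l; first exact: powR_ge0.
apply: ge0_ler_powR; rewrite ?nnegrE ?subr_ge0 //.
exact: lp_norm_coord.
Qed.

(** * Hoelder's inequality for diagonal operators, and its sharpness *)

Definition hadamard (R : realType) (n : nat) (a t : 'rV[R]_n) : 'rV[R]_n :=
  \row_i (a 0 i * t 0 i).

(** The relation 1/s = 1/q + 1/r with s finite and 1/oo = 0. Listing the cases replaces arithmetic
    on extended reals by case analysis. *)
Inductive holder_exponents (R : realType) :
    \bar R -> \bar R -> \bar R -> Prop :=
| HolderFin (s q r : R) of 0 < s & 0 < q & 0 < r & s^-1 = q^-1 + r^-1 :
    holder_exponents s%:E q%:E r%:E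
| HolderInfL (s : R) of 0 < s : holder_exponents s%:E +oo%E s%:E
| HolderInfR (s : R) of 0 < s : holder_exponents s%:E s%:E +oo%E.

Lemma holder_exponents_gt0 (R : realType) (s q r : \bar R) :
  holder_exponents s q r -> [/\ 0 < s, 0 < q & 0 < r]%E.
Proof. by case=> *; split; rewrite ?lte_fin ?ltry. Qed.

(** Young's inequality with the conjugate exponents r/s and q/s, applied to |a_i|^s and |t_i|^s and
    summed over i. *)
Lemma lp_norm_hadamard_le1 (R : realType) (s q r : R) (n : nat)
    (a t : 'rV[R]_n) : 0 < s -> 0 < q -> 0 < r -> s^-1 = q^-1 + r^-1 ->
  lp_norm r%:E a <= 1 -> lp_norm q%:E t <= 1 ->
  lp_norm s%:E (hadamard a t) <= 1.
Proof.
move=> s0 q0 r0 sqr a1 t1.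
have pow1 (u : R) : 1 = 1 `^ u :> R by rewrite powR1.
have pow_le1 (u : R) (x : 'rV[R]_n) : 0 < u -> lp_norm u%:E x <= 1 ->
    \sum_i `|x 0 i| `^ u <= 1.
  move=> u0 x1.
  rewrite -lp_norm_powR // [leRHS](pow1 u).
  by apply: ge0_ler_powR => //; rewrite ?nnegrE ?lp_norm_ge0 ?(ltW u0).
rewrite [leRHS](pow1 s^-1) /lp_norm.
have nn (u : R) (x : 'rV[R]_n) : 0 <= \sum_i `|x 0 i| `^ u.
  by apply: sumr_ge0 => j _; exact: powR_ge0.
apply: ge0_ler_powR; rewrite ?nnegrE ?invr_ge0 ?(ltW s0) //.
have sqr1 : (r / s)^-1 + (q / s)^-1 = 1.
  by rewrite !invf_div -mulrDr addrC -sqr divff // gt_eqF.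
apply: (@le_trans _ _
  (\sum_i (`|a 0 i| `^ r / (r / s) + `|t 0 i| `^ q / (q / s)))).
  apply: ler_sum => i _; rewrite mxE normrM powRM //.
  have := @conjugate_powR R (`|a 0 i| `^ s) (`|t 0 i| `^ s) (r / s) (q / s).
  rewrite !powR_ge0 !divr_gt0 // => /(_ isT isT isT isT sqr1).
  by rewrite -!powRrM !(mulrC s) !divfK ?gt_eqF.
rewrite big_split /= -!mulr_suml -sqr1 lerD //.
  by rewrite ler_piMl ?pow_le1 // ltW // invr_gt0 divr_gt0.
by rewrite ler_piMl ?pow_le1 // ltW // invr_gt0 divr_gt0.
Qed.

Lemma lp_norm_eq0 (R : realType) (p : \bar R) (n : nat) (x : 'rV[R]_n) :
  (0 < p)%E -> lp_norm p x = 0 -> x = 0.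
Proof.
move=> p0 x0; apply/rowP => i; rewrite mxE; apply/eqP.
by rewrite -normr_le0 -x0; exact: lp_norm_coord.
Qed.

Lemma lp_norm0 (R : realType) (p : \bar R) (n : nat) :
  (0 < p)%E -> lp_norm p (0 : 'rV[R]_n) = 0.
Proof. by move=> p0; rewrite -(scale0r 0) lp_normZ // normr0 mul0r. Qed.

(** With all exponents finite, homogeneity reduces to vectors of norm 1, after setting aside the
    case where one vector vanishes. With one exponent infinite, the corresponding factor is bounded
    coordinatewise by its maximum. *)
Lemma holder_lp_norm (R : realType) (s q r : \bar R) (n : nat)
    (a t : 'rV[R]_n) : holder_exponents s q r ->
  lp_norm s (hadamard a t) <= lp_norm r a * lp_norm q t.
Proof.
move=> sqr; have [s0 q0 r0] := holder_exponents_gt0 sqr.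
case: sqr s0 q0 r0 => {s q r} [s q r s0 q0 r0 sqr|s _|s _] sE qE rE.
- have [a0|aN0] := eqVneq (lp_norm r%:E a) 0.
    rewrite a0 (lp_norm_eq0 rE a0) mul0r.
    rewrite (_ : hadamard _ _ = 0) ?lp_norm0 //.
    by apply/rowP => i; rewrite !mxE mul0r.
  have [t0|tN0] := eqVneq (lp_norm q%:E t) 0.
    rewrite t0 (lp_norm_eq0 qE t0) mulr0.
    rewrite (_ : hadamard _ _ = 0) ?lp_norm0 //.
    by apply/rowP => i; rewrite !mxE mulr0.
  have apos : 0 < lp_norm r%:E a by rewrite lt_def aN0 lp_norm_ge0.
  have tpos : 0 < lp_norm q%:E t by rewrite lt_def tN0 lp_norm_ge0.
  have := @lp_norm_hadamard_le1 R s q r n ((lp_norm r%:E a)^-1 *: a)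
    ((lp_norm q%:E t)^-1 *: t) s0 q0 r0 sqr.
  rewrite (lp_normZ _ a rE) (lp_normZ _ t qE).
  move: (lp_norm r%:E a) (lp_norm q%:E t) aN0 tN0 apos tpos.
  move=> A B AN0 BN0 A0 B0.
  rewrite (gtr0_norm (_ : 0 < A^-1)) ?invr_gt0 // (gtr0_norm (_ : 0 < B^-1));
    rewrite ?invr_gt0 // !mulVf // => /(_ (lexx _) (lexx _)).
  rewrite (_ : hadamard _ _ = (A * B)^-1 *: hadamard a t); last first.
    by apply/rowP => i; rewrite !mxE invfM mulrACA.
  rewrite (lp_normZ _ _ sE) gtr0_norm ?invr_gt0 ?mulr_gt0 //.
  by rewrite mulrC ler_pdivrMr ?mulr_gt0 // mul1r.
- rewrite mulrC; apply: (ler_lp_normZ sE); first exact: lp_norm_ge0.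
  by move=> i; rewrite mxE normrM mulrC ler_wpM2r // (lp_norm_coord t).
- apply: (ler_lp_normZ sE); first exact: lp_norm_ge0.
  by move=> i; rewrite mxE normrM ler_wpM2r // (lp_norm_coord a).
Qed.

(** The bound is tested on extremal vectors. For finite exponents t_i = |a_i|^(r/q) turns both power
    sums into S, the sum of the |a_i|^r, so that S^(1/s) <= C S^(1/q), and dividing leaves S^(1/r)
    <= C. For q = +oo the test vector is constant 1; for r = +oo it runs over the standard basis. *)
Lemma holder_lp_norm_sharp (R : realType) (s q r : \bar R) (n : nat)
    (a : 'rV[R]_n) (C : R) : holder_exponents s q r -> 0 <= C ->
  (forall t, lp_norm s (hadamard a t) <= C * lp_norm q t) ->
  lp_norm r a <= C.
Proof.
move=> sqr; have [s0 q0 r0] := holder_exponents_gt0 sqr.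
case: sqr s0 q0 r0 => {s q r} [s q r s0 q0 r0 sqr|s _|s _] sE qE rE C0 hC.
- pose t : 'rV[R]_n := \row_i (`|a 0 i| `^ (r / q)).
  pose S := \sum_i `|a 0 i| `^ r.
  have S0 : 0 <= S by apply: sumr_ge0 => j _; exact: powR_ge0.
  have := hC t; rewrite /lp_norm.
  have -> : \sum_i `|hadamard a t 0 i| `^ s = S.
    apply: eq_bigr => i _.
    rewrite !mxE normrM powRM // [in X in _ * X]ger0_norm ?powR_ge0 //.
    rewrite -powRrM -powRD; last first.
      by rewrite gt_eqF // addr_gt0 // mulr_gt0 // divr_gt0.
    congr (_ `^ _).
    (* The exponents agree: s + (r/q) s = r (1/r + 1/q) s = r. *)
    rewrite -[r]mulr1 -[in RHS](mulVf (lt0r_neq0 s0)) sqr.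
    by field; rewrite !gt_eqF.
  have -> : \sum_i `|t 0 i| `^ q = S.
    apply: eq_bigr => i _; rewrite mxE ger0_norm ?powR_ge0 //.
    by rewrite -powRrM divfK // gt_eqF.
  rewrite -/S; have [->|SN0] := eqVneq S 0.
    by rewrite (powR0 (_ : r^-1 != 0)) // invr_eq0 gt_eqF.
  have Spos : 0 < S by rewrite lt_def SN0.
  rewrite sqr powRD ?SN0 ?implybT // mulrC.
  by rewrite ler_pM2r // powR_gt0.
- have := hC (const_mx 1); rewrite (_ : hadamard _ _ = a); last first.
    by apply/rowP => i; rewrite !mxE mulr1.
  move=> /le_trans; apply; rewrite ler_piMr //.
  by apply/bigmax_leP; split=> // i _; rewrite mxE normr1.
- apply/bigmax_leP; split=> // i _.
  have := hC (delta_mx 0 i); rewrite lp_norm_delta // mulr1; apply: le_trans.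
  have := @lp_norm_coord R s%:E n (hadamard a (delta_mx 0 i)) i sE.
  by rewrite !mxE !eqxx mulr1.
Qed.

(** * The exponent r, and diagonal multipliers between l_p and l_2 *)

(** By definition 1/r = |1/p - 1/2|, so the larger of 1/p and 1/2 is the smaller one plus 1/r. *)
Lemma bm_exponent_holder (R : realType) (p : \bar R) : (1 <= p)%E ->
  (p <= 2%:E)%E /\ holder_exponents p 2%:E (bm_exponent p) \/
  (2%:E <= p)%E /\ holder_exponents 2%:E p (bm_exponent p).
Proof.
case: p => [q||] // q1; last by right; split; [exact: leey|exact: HolderInfL].
rewrite /bm_exponent; have [->|qN2] := eqVneq q 2.
  by left; split=> //; exact: HolderInfR.
rewrite lee_fin in q1; have q0 : 0 < q := lt_le_trans ltr01 q1.
have [q2|q2|qE] := ltgtP q 2; last by rewrite qE eqxx in qN2.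
  left; split; first by rewrite lee_fin ltW.
  rewrite ltr0_norm ?subr_lt0 //; apply: HolderFin => //.
    by rewrite divr_gt0 ?mulr_gt0 // oppr_gt0 subr_lt0.
  by field; rewrite subr_eq0 qN2 gt_eqF.
right; split; first by rewrite lee_fin ltW.
rewrite gtr0_norm ?subr_gt0 //; apply: HolderFin => //.
  by rewrite divr_gt0 ?mulr_gt0 // subr_gt0.
by field; rewrite subr_eq0 qN2 gt_eqF.
Qed.

(** For finite p other than 2 this amounts to |p - 2| <= p, which is where p >= 1 enters. *)
Lemma bm_exponent_ge2 (R : realType) (p : \bar R) :
  (1 <= p)%E -> (2%:E <= bm_exponent p)%E.
Proof.
case: p => [q||] //; rewrite lee_fin /bm_exponent => q1.
have [_|qN2] := eqVneq q 2; first exact: leey.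
rewrite lee_fin ler_pdivlMr ?normr_gt0 ?subr_eq0 // ler_wpM2l //.
by rewrite ler_norml; apply/andP; split; lra.
Qed.

(** Supplies the rescaling of the blocks for the upper bound, [d] being their distortions. If p <=
    2, all of [d] goes into [m]: Hoelder bounds multiplication by [d] from l_2 to l_p, and the l_2
    norm is at most the l_p norm. If p >= 2 the roles are exchanged. *)
Lemma exists_multipliers (R : realType) (p : \bar R) (n : nat) (d : 'rV[R]_n) :
  (1 <= p)%E -> (forall i, 0 < d 0 i) ->
  exists (l m : 'rV[R]_n) (A B : R),
    [/\ forall i, [/\ 0 < l 0 i, 0 < m 0 i & l 0 i * m 0 i = d 0 i],
        0 <= A /\ 0 <= B,
        A * B = lp_norm (bm_exponent p) d,
        forall t, lp_norm 2%:E (hadamard l t) <= A * lp_norm p t &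
        forall t, lp_norm p (hadamard m t) <= B * lp_norm 2%:E t].
Proof.
move=> p1 d0; have p0 : (0 < p)%E by apply: lt_le_trans p1.
have had1 (t : 'rV[R]_n) : hadamard (const_mx 1) t = t.
  by apply/rowP => i; rewrite !mxE mul1r.
have [[p2 hp]|[p2 hp]] := bm_exponent_holder p1.
  exists (const_mx 1), d, 1, (lp_norm (bm_exponent p) d).
  split=> [i|||t|t].
  - by rewrite mxE mul1r.
  - by split; [exact: ler01|exact: lp_norm_ge0].
  - by rewrite mul1r.
  - by rewrite had1 mul1r; exact: ler_lp_norm_exponent.
  - exact: holder_lp_norm hp.
exists d, (const_mx 1), (lp_norm (bm_exponent p) d), 1.
split=> [i|||t|t].
- by rewrite mxE mulr1.
- by split; [exact: lp_norm_ge0|exact: ler01].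
- by rewrite mulr1.
- exact: holder_lp_norm hp.
- by rewrite had1 mul1r; exact: ler_lp_norm_exponent.
Qed.

(** The converse estimate, for the lower bound. Sharpness of Hoelder controls the l_r norm of one of
    the two multipliers; the entries of the other are bounded by testing on basis vectors. *)
Lemma lp_norm_multipliers (R : realType) (p : \bar R) (n : nat)
    (l m : 'rV[R]_n) (A B : R) : (1 <= p)%E -> 0 <= A -> 0 <= B ->
  (forall t, lp_norm 2%:E (hadamard l t) <= A * lp_norm p t) ->
  (forall t, lp_norm p (hadamard m t) <= B * lp_norm 2%:E t) ->
  lp_norm (bm_exponent p) (hadamard l m) <= A * B.
Proof.
move=> p1 A0 B0 hA hB; have p0 : (0 < p)%E by apply: lt_le_trans p1.
have r0 : (0 < bm_exponent p)%E.
  by apply: lt_le_trans (bm_exponent_ge2 p1); rewrite lte_fin.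
have coord (s q : \bar R) (a : 'rV[R]_n) C : (0 < s)%E -> (0 < q)%E ->
    (forall t, lp_norm s (hadamard a t) <= C * lp_norm q t) ->
    forall i, `|a 0 i| <= C.
  move=> s0 q0 hC i.
  have := hC (delta_mx 0 i); rewrite lp_norm_delta // mulr1; apply: le_trans.
  have := @lp_norm_coord R s n (hadamard a (delta_mx 0 i)) i s0.
  by rewrite !mxE !eqxx mulr1.
have [[p2 hp]|[p2 hp]] := bm_exponent_holder p1.
  have hm : lp_norm (bm_exponent p) m <= B.
    exact: holder_lp_norm_sharp hp _ _.
  apply: le_trans (ler_wpM2l A0 hm); apply: (ler_lp_normZ r0 A0) => i.
  by rewrite !mxE normrM ler_wpM2r // (coord 2%:E p _ _ _ _ hA).
have hl : lp_norm (bm_exponent p) l <= A by exact: holder_lp_norm_sharp hp _ _.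
rewrite mulrC; apply: le_trans (ler_wpM2l B0 hl).
apply: (ler_lp_normZ r0 B0) => i.
by rewrite !mxE normrM mulrC ler_wpM2r // (coord p 2%:E _ _ _ _ hB).
Qed.

(** * Norms on R^n and their comparison with the sup norm *)

Lemma mx_norm_coord (R : realType) (m n : nat) (x : 'M[R]_(m, n)) i j :
  `|x i j| <= `|x|.
Proof.
rewrite [leRHS]/Num.norm /= mx_normrE.
exact: (le_bigmax _ (fun ij : 'I_m * 'I_n => `|x ij.1 ij.2|) (i, j)).
Qed.

Lemma mx_norm_le (R : realType) (m n : nat) (x : 'M[R]_(m, n)) (c : R) :
  0 <= c -> (forall i j, `|x i j| <= c) -> `|x| <= c.
Proof.
move=> c0 xc; rewrite [leLHS]/Num.norm /= mx_normrE.
by apply/bigmax_leP; split=> // ij _; exact: xc.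
Qed.

(** Homogeneity together with a two-sided comparison with the sup norm is what the estimates on
    operator norms rely on. These properties pass directly from the summands to [lp_sum]. *)
Record gauge (R : realType) (n : nat) (N : 'rV[R]_n -> R) : Prop := Gauge {
  gauge_ge0 : forall x, 0 <= N x ;
  gaugeZ : forall (a : R) x, N (a *: x) = `|a| * N x ;
  gauge_norm_le : exists2 c, 0 <= c & forall x, `|x| <= c * N x ;
  gauge_le_norm : exists2 c, 0 <= c & forall x, N x <= c * `|x|
}.

Lemma gauge0 (R : realType) (n : nat) (N : 'rV[R]_n -> R) :
  gauge N -> N 0 = 0.
Proof. by move=> hN; rewrite -(scale0r 0) (gaugeZ hN) normr0 mul0r. Qed.

Lemma gauge_eq0 (R : realType) (n : nat) (N : 'rV[R]_n -> R) x :
  gauge N -> N x = 0 -> x = 0.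
Proof.
move=> hN Nx; have [c _ hc] := gauge_norm_le hN.
by apply/eqP; rewrite -normr_le0; have := hc x; rewrite Nx mulr0.
Qed.

Lemma gauge_lp_norm (R : realType) (p : \bar R) (n : nat) :
  (0 < p)%E -> gauge (@lp_norm R p n).
Proof.
move=> p0; split.
- by move=> x; exact: lp_norm_ge0.
- by move=> a x; exact: lp_normZ.
- exists 1 => // x; rewrite mul1r; apply: mx_norm_le; first exact: lp_norm_ge0.
  by move=> i j; rewrite (ord1 i); exact: lp_norm_coord.
- exists (lp_norm p (const_mx 1 : 'rV[R]_n)); first exact: lp_norm_ge0.
  move=> x; rewrite mulrC; apply: ler_lp_normZ => // i.
  by rewrite mxE normr1 mulr1; exact: mx_norm_coord.
Qed.

Lemma is_norm0 (R : realType) (V : lmodType R) (N : V -> R) :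
  is_norm N -> N 0 = 0.
Proof. by case=> _ NZ _; rewrite -(scale0r 0) NZ normr0 mul0r. Qed.

Lemma is_norm_ge0 (R : realType) (V : lmodType R) (N : V -> R) x :
  is_norm N -> 0 <= N x.
Proof.
move=> hN; have := is_norm_triangle hN x (- 1 *: x).
rewrite (is_norm_homogeneous hN) normrN1 mul1r scaleN1r subrr is_norm0 //.
by rewrite -mulr2n pmulrn_lge0.
Qed.

Lemma is_norm_sum (R : realType) (V : lmodType R) (N : V -> R) (I : Type)
    (s : seq I) (v : I -> V) :
  is_norm N -> N (\sum_(i <- s) v i) <= \sum_(i <- s) N (v i).
Proof.
move=> hN; elim/big_rec2 : _ => [|i y z _ h]; first by rewrite is_norm0.
by apply: le_trans (is_norm_triangle hN _ _) _; rewrite lerD2l.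
Qed.

Lemma is_norm_le_norm (R : realType) (n : nat) (N : 'rV[R]_n -> R) :
  is_norm N -> exists2 c, 0 <= c & forall x, N x <= c * `|x|.
Proof.
move=> hN; exists (\sum_(i < n) N (delta_mx 0 i)).
  by apply: sumr_ge0 => i _; exact: is_norm_ge0.
move=> x; rewrite {1}[x]row_sum_delta; apply: le_trans (is_norm_sum _ _ hN) _.
rewrite mulr_suml; apply: ler_sum => i _.
rewrite (is_norm_homogeneous hN) mulrC ler_wpM2l ?is_norm_ge0 //.
exact: mx_norm_coord.
Qed.

Lemma is_norm_continuous (R : realType) (n : nat) (N : 'rV[R]_n -> R) :
  is_norm N -> continuous N.
Proof.
move=> hN; have [c c0 hc] := is_norm_le_norm hN.
have lip x y : `|N x - N y| <= c * `|x - y|.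
  have half u v : N u - N v <= c * `|u - v|.
    rewrite lerBlDl -lerBlDl; apply: le_trans (hc _); rewrite lerBlDl.
    by have := is_norm_triangle hN v (u - v); rewrite subrKC.
  by rewrite ler_norml half andbT lerNl opprB distrC half.
move=> x; apply/(@cvgrPdist_le R R^o 'rV[R]_n (nbhs x) _ N (N x)) => e e0.
near=> y.
apply: le_trans (lip x y) _.
(* The divisor c + 1 stays positive when c = 0. *)
have : `|x - y| <= e / (c + 1).
  near: y; apply: (@cvgr_dist_le _ _ _ _ _ id x); first exact: cvg_id.
  by rewrite divr_gt0 // ltr_wpDl.
rewrite ler_pdivlMr ?ltr_wpDl // => h; apply: le_trans h.
by rewrite mulrC ler_wpM2l // lerDl.
Unshelve. all: by end_near.
Qed.

(** By compactness, [N] attains a positive minimum on the unit sphere of the sup norm; its inverse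
    is the missing constant. *)
Lemma gauge_is_norm (R : realType) (n : nat) (N : 'rV[R]_n -> R) :
  is_norm N -> gauge N.
Proof.
move=> hN; split; [by move=> x; exact: is_norm_ge0
  |exact: is_norm_homogeneous| |exact: is_norm_le_norm].
pose S := [set x : 'rV[R]_n | `|x| = 1].
(* The sphere is empty in dimension 0, where every vector is zero. *)
have [S0|/set0P nS] := eqVneq S set0.
  exists 0 => // x; rewrite mul0r normr_le0; apply/contraT => x0.
  suff : S (`|x|^-1 *: x) by rewrite S0.
  rewrite /S /= normrZ ger0_norm ?invr_ge0 // mulVf // normr_eq0 //.
have cS : compact S.
  apply: bounded_closed_compact.
    exists 1; split; first exact: num_real.
    by move=> e e1 x /= ->; exact: ltW.
  have -> : S = (fun x : 'rV[R]_n => `|x|) @^-1` [set 1] by [].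
  apply: closed_comp; last exact: closed_eq.
  by move=> x _; exact: norm_continuous.
have [x0 x0S min0] := EVT_min_rV nS cS
  (continuous_subspaceT (is_norm_continuous hN)).
have N0 : 0 < N x0.
  rewrite lt_def is_norm_ge0 // andbT.
  apply/negP => /eqP/(is_norm_definite hN) e.
  by move: x0S; rewrite inE /S /= e normr0 => /esym/eqP; rewrite oner_eq0.
exists (N x0)^-1; first by rewrite invr_ge0 ltW.
move=> x; rewrite mulrC ler_pdivlMr //.
have [->|xN0] := eqVneq x 0; first by rewrite normr0 mul0r is_norm_ge0.
have nx0 : 0 < `|x| by rewrite normr_gt0.
have := min0 (`|x|^-1 *: x).
rewrite (is_norm_homogeneous hN) ger0_norm ?invr_ge0 //.
rewrite mulrC ler_pdivlMr // mulrC; apply; rewrite inE /S /=.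
by rewrite normrZ ger0_norm ?invr_ge0 // mulVf // gt_eqF.
Qed.

Lemma norm_submxrow_le (R : realType) (k : nat) (n : 'I_k -> nat)
    (x : 'rV[R]_(\sum_(i < k) n i)%N) i : `|submxrow x i| <= `|x|.
Proof. by apply: mx_norm_le => // j l; rewrite mxE; exact: mx_norm_coord. Qed.

(** The constants of the blocks are made uniform by summing them over all blocks. *)
Lemma gauge_lp_sum (R : realType) (p : \bar R) (k : nat) (n : 'I_k -> nat)
    (N : forall i, 'rV[R]_(n i) -> R) :
  (0 < p)%E -> (forall i, gauge (N i)) -> gauge (lp_sum p N).
Proof.
move=> p0 hN.
have /fin_all_exists [c hc] : forall i, exists c,
    0 <= c /\ forall x, `|x| <= c * N i x.
  by move=> i; have [c c0 hc] := gauge_norm_le (hN i); exists c.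
have /fin_all_exists [d hd] : forall i, exists d,
    0 <= d /\ forall x, N i x <= d * `|x|.
  by move=> i; have [d d0 hd] := gauge_le_norm (hN i); exists d.
have le_sum (f : 'I_k -> R) i : (forall j, 0 <= f j) -> f i <= \sum_j f j.
  by move=> f0; rewrite (bigD1 i) //= lerDl sumr_ge0.
split.
- by move=> x; exact: lp_norm_ge0.
- move=> a x; rewrite -normr_id -lp_normZ //; congr lp_norm; apply/rowP => i.
  rewrite !mxE -(gaugeZ (hN i)).
  by congr (N i _); apply/rowP => j; rewrite !mxE.
- have c0 : 0 <= \sum_i c i by apply: sumr_ge0 => i _; case: (hc i).
  exists (\sum_i c i) => // x.
  apply: mx_norm_le => [|u s]; first by rewrite mulr_ge0 // lp_norm_ge0.
  rewrite (ord1 u) -[x in leLHS]submxrowK mxE; set i := tagnat.sig1 s.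
  apply: le_trans (mx_norm_coord _ _ _) _.
  have [ci0 hci] := hc i; apply: le_trans (hci _) _.
  apply: ler_pM => //; first exact: (gauge_ge0 (hN i)).
    by apply: le_sum => j; case: (hc j).
  have := @lp_norm_coord R p k (\row_j N j (submxrow x j)) i p0.
  by rewrite mxE ger0_norm // (gauge_ge0 (hN i)).
have d0 : 0 <= \sum_i d i by apply: sumr_ge0 => i _; case: (hd i).
exists ((\sum_i d i) * lp_norm p (const_mx 1 : 'rV[R]_k)).
  by rewrite mulr_ge0 // lp_norm_ge0.
move=> x; rewrite mulrAC; apply: ler_lp_normZ => //; first by rewrite mulr_ge0.
move=> i; rewrite !mxE normr1 mulr1 ger0_norm ?(gauge_ge0 (hN i)) //.
have [di0 hdi] := hd i; apply: le_trans (hdi _) _.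
apply: ler_pM => //; last exact: norm_submxrow_le.
by apply: le_sum => j; case: (hd j).
Qed.

(** * Operator norms of linear maps between gauges *)

Lemma gauge_linear_bounded (R : realType) (m n : nat) (N : 'rV[R]_m -> R)
    (M : 'rV[R]_n -> R) (P : 'M[R]_(m, n)) : gauge N -> gauge M ->
  exists2 c, 0 <= c & forall x, M (x *m P) <= c * N x.
Proof.
move=> hN hM; have [a a0 ha] := gauge_norm_le hN.
have [b b0 hb] := gauge_le_norm hM.
pose s := \sum_i `|row i P|; have s0 : 0 <= s by apply: sumr_ge0.
exists (b * s * a); first by rewrite !mulr_ge0.
move=> x; apply: le_trans (hb _) _; rewrite -!mulrA ler_wpM2l //.
apply: (@le_trans _ _ (s * `|x|)); last by rewrite ler_wpM2l.
rewrite mulmx_sum_row; apply: le_trans (ler_norm_sum _ _ _) _.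
rewrite mulr_suml; apply: ler_sum => i _.
by rewrite normrZ mulrC ler_wpM2l // mx_norm_coord.
Qed.

Lemma op_norm_nonempty (R : realType) (m n : nat) (N : 'rV[R]_m -> R)
    (M : 'rV[R]_n -> R) (T : 'rV[R]_m -> 'rV[R]_n) : gauge N ->
  [set M (T x) | x in [set x | N x <= 1]] !=set0.
Proof. by move=> hN; exists (M (T 0)), 0 => //=; rewrite gauge0. Qed.

Lemma op_norm_le (R : realType) (m n : nat) (N : 'rV[R]_m -> R)
    (M : 'rV[R]_n -> R) (T : 'rV[R]_m -> 'rV[R]_n) (c : R) : gauge N ->
  0 <= c -> (forall x, M (T x) <= c * N x) -> op_norm N M T <= c.
Proof.
move=> hN c0 hc; apply: ge_sup; first exact: op_norm_nonempty.
move=> _ [x /= x1 <-]; apply: le_trans (hc x) _.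
by rewrite ler_piMr.
Qed.

(** Boundedness makes the real [sup] in [op_norm] a genuine least upper bound. *)
Lemma op_norm_has_sup (R : realType) (m n : nat) (N : 'rV[R]_m -> R)
    (M : 'rV[R]_n -> R) (T : {linear 'rV[R]_m -> 'rV[R]_n}) :
  gauge N -> gauge M -> has_sup [set M (T x) | x in [set x | N x <= 1]].
Proof.
move=> hN hM; split; first exact: op_norm_nonempty.
have [c c0 hc] := gauge_linear_bounded (lin1_mx T) hN hM.
exists c => _ [x /= x1 <-]; rewrite -mul_rV_lin1.
by apply: le_trans (hc x) _; rewrite ler_piMr.
Qed.

Lemma op_norm_ge0 (R : realType) (m n : nat) (N : 'rV[R]_m -> R)
    (M : 'rV[R]_n -> R) (T : {linear 'rV[R]_m -> 'rV[R]_n}) :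
  gauge N -> gauge M -> 0 <= op_norm N M T.
Proof.
move=> hN hM; apply: ub_le_sup; first by case: (op_norm_has_sup T hN hM).
by exists 0; rewrite /= ?gauge0 // linear0 gauge0.
Qed.

Lemma op_normP (R : realType) (m n : nat) (N : 'rV[R]_m -> R)
    (M : 'rV[R]_n -> R) (T : {linear 'rV[R]_m -> 'rV[R]_n}) x :
  gauge N -> gauge M -> M (T x) <= op_norm N M T * N x.
Proof.
move=> hN hM; have [Nx0|NxN0] := eqVneq (N x) 0.
  by rewrite (gauge_eq0 hN Nx0) linear0 !gauge0 // mulr0.
have Nx : 0 < N x by rewrite lt_def NxN0 gauge_ge0.
rewrite -ler_pdivrMr // mulrC.
rewrite -[X in X * _](ger0_norm (_ : 0 <= (N x)^-1)) ?invr_ge0 ?gauge_ge0 //.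
rewrite -(gaugeZ hM) -linearZ.
apply: ub_le_sup; first by case: (op_norm_has_sup T hN hM).
exists ((N x)^-1 *: x) => //=.
by rewrite (gaugeZ hN) ger0_norm ?invr_ge0 ?gauge_ge0 // mulVf.
Qed.

(** Approximate attainment of the supremum, in multiplicative form so that operator norm 0 is
    covered; [ler_scaled_lt1] later removes the factor [theta]. *)
Lemma op_norm_approx (R : realType) (m n : nat) (N : 'rV[R]_m -> R)
    (M : 'rV[R]_n -> R) (T : {linear 'rV[R]_m -> 'rV[R]_n}) (theta : R) :
  gauge N -> gauge M -> 0 < theta < 1 ->
  exists2 x, N x <= 1 & theta * op_norm N M T <= M (T x).
Proof.
move=> hN hM /andP[t0 t1]; have := op_norm_ge0 T hN hM.
rewrite le_eqVlt => /predU1P[<-|op0].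
  by exists 0; rewrite ?gauge0 // mulr0 linear0 gauge0.
have e0 : 0 < (1 - theta) * op_norm N M T by rewrite mulr_gt0 // subr_gt0.
have [_ [x /= x1 <-] hx] := sup_adherent e0 (op_norm_has_sup T hN hM).
exists x => //; apply/ltW; apply: le_lt_trans hx.
by rewrite -/(op_norm N M T) mulrBl mul1r subKr.
Qed.

(** * The Banach-Mazur distance through pairs of inverse matrices *)

(** Any admissible constants bound the operator norms from above, so the infimum can be estimated
    without computing these norms. *)
Lemma banach_mazur_le (R : realType) (n : nat) (N M : 'rV[R]_n -> R)
    (P Q : 'M[R]_n) (a b : R) : gauge N -> gauge M ->
  P *m Q = 1%:M -> 0 <= a -> 0 <= b ->
  (forall x, M (x *m P) <= a * N x) -> (forall x, N (x *m Q) <= b * M x) ->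
  banach_mazur N M <= a * b.
Proof.
move=> hN hM PQ a0 b0 ha hb.
apply: (@le_trans _ _ (op_norm N M (mulmxr P) * op_norm M N (mulmxr Q))).
  apply: ge_inf.
    by exists 0 => _ [T [S [_ _ ->]]]; rewrite mulr_ge0 // op_norm_ge0.
  exists (mulmxr P), (mulmxr Q); split=> // x /=.
    by rewrite -mulmxA PQ mulmx1.
  by rewrite -mulmxA (mulmx1C PQ) mulmx1.
by apply: ler_pM; rewrite ?op_norm_ge0 //; exact: op_norm_le.
Qed.

Lemma banach_mazur_nonempty (R : realType) (n : nat) (N M : 'rV[R]_n -> R) :
  [set c | exists (T S : {linear 'rV[R]_n -> 'rV[R]_n}),
         [/\ cancel T S, cancel S T & c = op_norm N M T * op_norm M N S]]
  !=set0.
Proof.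
by eexists; exists (mulmxr 1%:M), (mulmxr 1%:M); split=> [x|x|] //=;
  rewrite !mulmx1.
Qed.

Lemma banach_mazur_ge (R : realType) (n : nat) (N M : 'rV[R]_n -> R) (c : R) :
  gauge N -> gauge M ->
  (forall (P Q : 'M[R]_n) (a b : R), P *m Q = 1%:M -> 0 <= a -> 0 <= b ->
    (forall x, M (x *m P) <= a * N x) -> (forall x, N (x *m Q) <= b * M x) ->
    c <= a * b) ->
  c <= banach_mazur N M.
Proof.
move=> hN hM hc; apply: lb_le_inf; first exact: banach_mazur_nonempty.
move=> _ [T [S [TS ST ->]]].
apply: (hc (lin1_mx T) (lin1_mx S)); rewrite ?op_norm_ge0 //.
- by apply/row_matrixP => i; rewrite !rowE mulmxA !mul_rV_lin1 TS mulmx1.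
- by move=> x; rewrite mul_rV_lin1; exact: op_normP.
- by move=> x; rewrite mul_rV_lin1; exact: op_normP.
Qed.

Lemma banach_mazur_approx (R : realType) (n : nat) (N M : 'rV[R]_n -> R)
    (c : R) : gauge N -> gauge M -> banach_mazur N M < c ->
  exists (P Q : 'M[R]_n) (a b : R),
    [/\ P *m Q = 1%:M, 0 <= a /\ 0 <= b,
        forall x, M (x *m P) <= a * N x, forall x, N (x *m Q) <= b * M x &
        a * b < c].
Proof.
move=> hN hM hc; apply/not_existsP => h.
suff : c <= banach_mazur N M by rewrite leNgt hc.
apply: banach_mazur_ge => // P Q a b PQ a0 b0 ha hb.
by rewrite leNgt; apply/negP => ab; apply: (h P); exists Q, a, b.
Qed.

(** Going through [P] and then [Q] returns x to itself, so N x <= b a N x. Positive dimension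
    supplies a nonzero x to divide by. *)
Lemma banach_mazur_factors_ge1 (R : realType) (n : nat) (N M : 'rV[R]_n -> R)
    (P Q : 'M[R]_n) (a b : R) : (0 < n)%N -> gauge N -> gauge M ->
  P *m Q = 1%:M -> 0 <= a -> 0 <= b ->
  (forall x, M (x *m P) <= a * N x) -> (forall x, N (x *m Q) <= b * M x) ->
  1 <= a * b.
Proof.
move=> n0 hN hM PQ a0 b0 ha hb.
pose x : 'rV[R]_n := const_mx 1.
have Nx : 0 < N x.
  rewrite lt_def gauge_ge0 // andbT; apply/negP => /eqP/(gauge_eq0 hN).
  by move=> /rowP/(_ (Ordinal n0))/eqP; rewrite !mxE oner_eq0.
rewrite -(ler_pM2r Nx) mul1r -{1}[x]mulmx1 -PQ mulmxA mulrAC mulrC.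
by apply: le_trans (hb _) _; rewrite ler_wpM2l.
Qed.

Lemma banach_mazur_ge1 (R : realType) (n : nat) (N M : 'rV[R]_n -> R) :
  (0 < n)%N -> gauge N -> gauge M -> 1 <= banach_mazur N M.
Proof.
move=> n0 hN hM; apply: banach_mazur_ge => // P Q a b.
exact: banach_mazur_factors_ge1.
Qed.

(** * Euclidean geometry: Cholesky factors, isometries and signs *)

Lemma lp_norm2_sqr_mulmx (R : realType) (n : nat) (x : 'rV[R]_n) :
  lp_norm 2%:E x ^+ 2 = (x *m x^T) 0 0.
Proof.
by rewrite lp_norm2_sqr mxE; apply: eq_bigr => i _; rewrite mxE expr2.
Qed.

Lemma lp_norm2_sqrD (R : realType) (n : nat) (x y : 'rV[R]_n) :
  lp_norm 2%:E (x + y) ^+ 2 =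
  lp_norm 2%:E x ^+ 2 + 2 * (x *m y^T) 0 0 + lp_norm 2%:E y ^+ 2.
Proof.
rewrite [LHS]lp_norm2_sqr [X in _ = X + _ + _]lp_norm2_sqr.
rewrite [X in _ = _ + X]lp_norm2_sqr mxE mulr_sumr -!big_split /=.
by apply: eq_bigr => i _; rewrite !mxE; ring.
Qed.

(** Induction on the size through the Schur complement D - b^T b / s of the top left entry s, which
    is again symmetric and positive definite. *)
Lemma cholesky (R : realType) (m : nat) (G : 'M[R]_m) : G^T = G ->
  (forall v : 'rV[R]_m, v != 0 -> 0 < (v *m G *m v^T) 0 0) ->
  exists P : 'M[R]_m, P *m P^T = G.
Proof.
elim: m G => [|m IH] G symG posG.
  by exists 0; apply/matrixP => -[].
rewrite -[m.+1]/(1 + m)%N in G symG posG *.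
pose s := G 0 0; pose b : 'rV[R]_m := ursubmx G; pose D : 'M[R]_m := drsubmx G.
have GE : G = block_mx s%:M b b^T D.
  rewrite -[LHS]submxK; congr block_mx; last by rewrite -{1}symG trmx_ursub.
  by rewrite [LHS]mx11_scalar !mxE; congr (G _ _)%:M; apply: val_inj.
have symD : D^T = D.
  by rewrite /D trmx_drsub symG.
have s0 : 0 < s.
  have := posG (row_mx 1%:M 0); rewrite GE mul_row_block !mul0mx !addr0 !mul1mx.
  rewrite tr_row_mx trmx1 trmx0 mul_row_col mulmx0 addr0 mulmx1 mxE.
  rewrite eqxx mulr1n; apply.
  apply/eqP => /(congr1 lsubmx); rewrite row_mxKl linear0 => /rowP/(_ 0)/eqP.
  by rewrite !mxE oner_eq0.
have [P' P'E] : exists P' : 'M[R]_m, P' *m P'^T = D - s^-1 *: (b^T *m b).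
  apply: IH => [|w w0].
    by rewrite linearB linearZ /= trmx_mul trmxK symD.
  (* The first coordinate is chosen so that the first coordinate of v G vanishes; the quadratic form
     of G at v is then that of the Schur complement at w. *)
  have := posG (row_mx (- s^-1 *: (w *m b^T)) w).
  rewrite GE mul_row_block mul_mx_scalar scalerA mulrN divff ?gt_eqF //.
  rewrite scaleN1r addNr tr_row_mx mul_row_col mul0mx add0r.
  rewrite (_ : _ *m b + w *m D = w *m (D - s^-1 *: (b^T *m b))); last first.
    by rewrite mulmxBr -scalemxAr mulmxA -scalemxAl scaleNr addrC.
  apply.
  apply: contraNneq w0 => /(congr1 rsubmx).
  by rewrite row_mxKr linear0 => ->.
pose q := Num.sqrt s; have q0 : 0 < q by rewrite sqrtr_gt0.
have qq : q * q = s by rewrite -expr2 sqr_sqrtr // ltW.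
exists (block_mx q%:M 0 (q^-1 *: b^T) P').
rewrite tr_block_mx mulmx_block GE.
rewrite !(trmx0, mul0mx, mulmx0, addr0, tr_scalar_mx).
rewrite P'E linearZ /= trmxK mul_mx_scalar mul_scalar_mx.
rewrite -!scalemxAl -!scalemxAr.
rewrite !scalerA -invfM qq subrKC mul_mx_scalar scalerA mulVf ?gt_eqF //.
by rewrite divff ?gt_eqF // !scale1r scale_scalar_mx qq.
Qed.

(** Identifies the image of A with l_2^m: injectivity makes the Gram matrix A A^T positive definite,
    and a square Cholesky factor has the same Gram matrix, hence gives the same lengths. *)
Lemma square_isometry (R : realType) (m n : nat) (A : 'M[R]_(m, n)) :
  (forall x : 'rV[R]_m, x *m A = 0 -> x = 0) ->
  exists2 P : 'M[R]_m, P \in unitmx &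
    forall x : 'rV[R]_m, lp_norm 2%:E (x *m P) = lp_norm 2%:E (x *m A).
Proof.
move=> injA.
have sqE (v : 'rV[R]_m) :
    (v *m (A *m A^T) *m v^T) 0 0 = lp_norm 2%:E (v *m A) ^+ 2.
  by rewrite lp_norm2_sqr_mulmx trmx_mul !mulmxA.
have e20 : (0 < 2%:E :> \bar R)%E by rewrite lte_fin.
have [P PE] : exists P : 'M[R]_m, P *m P^T = A *m A^T.
  apply: cholesky => [|v v0]; first by rewrite trmx_mul trmxK.
  rewrite sqE exprn_gt0 // lt_def lp_norm_ge0 andbT.
  by apply: contraNneq v0 => /(lp_norm_eq0 e20)/injA ->.
have normE (x : 'rV[R]_m) : lp_norm 2%:E (x *m P) = lp_norm 2%:E (x *m A).
  apply/eqP; rewrite -(eqrXn2 (n := 2)) ?lp_norm_ge0 //.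
  by rewrite -sqE -PE lp_norm2_sqr_mulmx trmx_mul !mulmxA.
exists P => //; rewrite -row_free_unit; apply/inj_row_free => v vP.
by apply: injA; apply: (lp_norm_eq0 e20); rewrite -normE vP lp_norm0.
Qed.

(* Choosing each sign according to the inner product with the partial sum makes
   every cross term have the sign of [c]. *)
Lemma exists_signs (R : realType) (n : nat) (I : eqType) (s : seq I)
    (v : I -> 'rV[R]_n) (c : R) : uniq s ->
  exists2 e : I -> R, forall i, `|e i| = 1 &
    0 <= c * (lp_norm 2%:E (\sum_(i <- s) e i *: v i) ^+ 2
              - \sum_(i <- s) lp_norm 2%:E (v i) ^+ 2).
Proof.
move=> us; pose sq (x : 'rV[R]_n) := lp_norm 2%:E x ^+ 2.
suff : exists2 e : I -> R, forall i, `|e i| = 1 &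
  0 <= c * (sq (\sum_(i <- s) e i *: v i) - \sum_(i <- s) sq (v i)) by [].
have sq0 : sq 0 = 0 by rewrite /sq lp_norm0 ?lte_fin // expr0n.
have sqD x y : sq (x + y) = sq x + 2 * (x *m y^T) 0 0 + sq y.
  exact: lp_norm2_sqrD.
have sqZ e x : `|e| = 1 -> sq (e *: x) = sq x.
  by move=> e1; rewrite /sq lp_normZ ?lte_fin // e1 mul1r.
clearbody sq; elim: s us => [_|x s IH /= /andP[xs us]].
  exists (fun=> 1) => [i|]; first by rewrite normr1.
  by rewrite !big_nil sq0 subr0 mulr0.
have [e e1 he] := IH us; set S := \sum_(i <- s) e i *: v i in he.
pose d := (v x *m S^T) 0 0.
pose ex : R := if 0 <= c * d then 1 else -1.
have ex1 : `|ex| = 1 by rewrite /ex; case: ifP; rewrite ?normrN normr1.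
have exd : 0 <= c * (ex * d).
  rewrite /ex; case: ifPn; first by rewrite mul1r.
  by rewrite -ltNge mulN1r mulrN oppr_ge0 => /ltW.
exists (fun i => if i == x then ex else e i) => [i|]; first by case: ifP.
rewrite !big_cons eqxx (_ : \sum_(i <- s) _ = S); last first.
  rewrite /S; apply: eq_big_seq => i si.
  by case: eqP => // ix; rewrite -ix si in xs.
rewrite sqD -scalemxAl mxE -/d sqZ //.
by have := addr_ge0 he (addr_ge0 exd exd); congr (0 <= _); ring.
Qed.

Lemma block_diagonal_bounds (R : realType) (p : \bar R) (k : nat)
    (n : 'I_k -> nat) (N : forall i, 'rV[R]_(n i) -> R)
    (P Q : 'M[R]_(\sum_(i < k) n i)%N) (a b : R) :
  (0 < p)%E -> (forall i, gauge (N i)) -> P *m Q = 1%:M -> 0 <= a -> 0 <= b ->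
  (forall x, lp_norm 2%:E (x *m P) <= a * lp_sum p N x) ->
  (forall x, lp_sum p N (x *m Q) <= b * lp_norm 2%:E x) ->
  forall x : forall i, 'rV[R]_(n i),
    lp_norm 2%:E (\row_i lp_norm 2%:E (x i *m submxcol P i)) <=
      a * lp_norm p (\row_i N i (x i)) /\
    lp_norm p (\row_i N i (x i)) <=
      b * lp_norm 2%:E (\row_i lp_norm 2%:E (x i *m submxcol P i)).
Proof.
move=> p0 hN PQ a0 b0 ha hb x.
pose X (e : 'I_k -> R) := \mxrow_i (e i *: x i).
pose v i := x i *m submxcol P i.
have XP e : X e *m P = \sum_i e i *: v i.
  rewrite -{1}[P]submxcolK mul_mxrow_mxcol.
  by apply: eq_bigr => i _; rewrite scalemxAl.
have NX e : (forall i, `|e i| = 1) ->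
    lp_sum p N (X e) = lp_norm p (\row_i N i (x i)).
  move=> e1; apply: eq_lp_norm => // i.
  by rewrite !mxE mxrowK (gaugeZ (hN i)) e1 mul1r.
have rowE : lp_norm 2%:E (\row_i lp_norm 2%:E (v i)) ^+ 2
    = \sum_i lp_norm 2%:E (v i) ^+ 2.
  by rewrite lp_norm2_sqr; apply: eq_bigr => i _; rewrite mxE.
split.
  (* The value c = 1 yields signs for which the signed sum is at least as long as if the [v i] were
     orthogonal. *)
  have [e e1] := exists_signs v 1 (index_enum_uniq 'I_k).
  rewrite mul1r subr_ge0 -rowE ler_pXn2r ?nnegrE ?lp_norm_ge0 // => h.
  by apply: le_trans h _; rewrite -(NX e) // -XP.
(* The value c = -1 yields signs for which it is at most that long. *)
have [e e1] := exists_signs v (-1) (index_enum_uniq 'I_k).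
rewrite mulN1r opprB subr_ge0 -rowE ler_pXn2r ?nnegrE ?lp_norm_ge0 // => h.
rewrite -(NX e) // -{1}[X e]mulmx1 -PQ mulmxA; apply: le_trans (hb _) _.
by rewrite XP; exact: ler_wpM2l b0 _ _ h.
Qed.

Lemma ler_scaled_lt1 (R : realFieldType) (x y : R) : 0 <= y ->
  (forall theta, 0 < theta < 1 -> theta * x <= y) -> x <= y.
Proof.
move=> y0 h; rewrite leNgt; apply/negP => yx.
have x0 : 0 < x by apply: le_lt_trans yx.
(* If y < x, this [theta] sends x to the midpoint of x and y, which exceeds y. *)
have : (x + y) / (2 * x) * x <= y.
  apply: h; rewrite divr_gt0 ?mulr_gt0 ?ltr_wpDr //= ltr_pdivrMr ?mulr_gt0 //.
  by lra.
rewrite (_ : (x + y) / (2 * x) * x = (x + y) / 2); last first.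
  by field; rewrite gt_eqF.
by lra.
Qed.

(** * The two inequalities between the distances *)

Lemma banach_mazur_lp_sum_le (R : realType) (k : nat)
    (n : 'I_k -> nat) (N : forall i : 'I_k, 'rV[R]_(n i) -> R) (p : \bar R) :
  (1 <= p)%E -> (forall i, 0 < n i)%N -> (forall i, gauge (N i)) ->
  banach_mazur (lp_sum p N) (@lp_norm R 2%:E (\sum_(i < k) n i)%N) <=
  lp_norm (bm_exponent p)
      (\row_(i < k) banach_mazur (N i) (@lp_norm R 2%:E (n i))).
Proof.
move=> p1 n0 hN; have p0 : (0 < p)%E by apply: lt_le_trans p1.
have e20 : (0 < 2%:E :> \bar R)%E by rewrite lte_fin.
have r0 : (0 < bm_exponent p)%E.
  by apply: lt_le_trans (bm_exponent_ge2 p1).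
have h2 m := @gauge_lp_norm R 2%:E m e20.
set d := \row_i _; apply: ler_scaled_lt1; first exact: lp_norm_ge0.
move=> theta /andP[t0 t1]; rewrite mulrC -ler_pdivlMr //.
have dE i : d 0 i = banach_mazur (N i) (@lp_norm R 2%:E (n i)) by rewrite mxE.
have d1 i : 1 <= d 0 i by rewrite dE; exact: banach_mazur_ge1.
have dpos i : 0 < d 0 i by apply: lt_le_trans (d1 i).
(* Since d_i >= 1 is positive, d_i / theta leaves room for a nearly optimal pair on each block. *)
have /fin_all_exists [P] : forall i, exists (P : 'M[R]_(n i)),
    exists (Q : 'M[R]_(n i)) (ab : R * R),
    [/\ P *m Q = 1%:M, 0 < ab.1 /\ 0 < ab.2,
      forall x, lp_norm 2%:E (x *m P) <= ab.1 * N i x,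
      forall x, N i (x *m Q) <= ab.2 * lp_norm 2%:E x &
      ab.1 * ab.2 < d 0 i / theta].
  move=> i; have : banach_mazur (N i) (@lp_norm R 2%:E (n i)) < d 0 i / theta.
    by rewrite -dE ltr_pdivlMr // gtr_pMr.
  case/(banach_mazur_approx (hN i) (h2 _)).
  move=> P [Q] [a] [b] [PQ [a0 b0] ha hb ab].
  exists P, Q, (a, b); split=> //=.
  (* A product at least 1 of nonnegative constants makes both positive, so that they can serve as
     divisors. *)
  have ab1 := banach_mazur_factors_ge1 (n0 i) (hN i) (h2 _) PQ a0 b0 ha hb.
  have abpos : 0 < a * b by apply: lt_le_trans ab1.
  rewrite !lt_def a0 b0 !andbT; apply/andP; rewrite -negb_or -mulf_eq0.
  by rewrite gt_eqF.
move=> /fin_all_exists [Q] /fin_all_exists [ab hab].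
pose d' : 'rV[R]_k := \row_i ((ab i).1 * (ab i).2).
have ab0 i : 0 < (ab i).1 /\ 0 < (ab i).2 by case: (hab i).
have d'0 i : 0 < d' 0 i by have [a0 b0] := ab0 i; rewrite mxE mulr_gt0.
have [l [m [A [B [lm [A0 B0] AB hl hm]]]]] := exists_multipliers p1 d'0.
apply: (@le_trans _ _ (A * B)); last first.
  rewrite AB mulrC; apply: (ler_lp_normZ r0); first by rewrite invr_ge0 ltW.
  move=> i.
  rewrite !gtr0_norm // [leLHS]mxE [leRHS]mulrC; apply: ltW.
  by case: (hab i).
(* With this scaling c_i P_i has bound c_i a_i = l_i, and its inverse has bound b_i / c_i = a_i b_i
   / l_i = m_i. *)
pose c i := l 0 i / (ab i).1.
have c0 i : 0 < c i.
  by rewrite divr_gt0 //; [case: (lm i)|case: (ab0 i)].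
have mE i : (c i)^-1 * (ab i).2 = m 0 i.
  have [l0 _ /eqP] := lm i; rewrite mxE => /eqP lme.
  have [a0 _] := ab0 i.
  by rewrite invf_div mulrAC -lme mulrC mulKf ?gt_eqF.
have cE i : c i * (ab i).1 = l 0 i.
  by have [a0 _] := ab0 i; rewrite divfK ?gt_eqF.
clearbody c; have mul_diag (D : forall i, 'M[R]_(n i)) x j :
    submxrow (x *m \mxdiag_i D i) j = submxrow x j *m D j.
  by rewrite -{1}[x]submxrowK mul_mxrow_mxdiag mxrowK.
have lp2E (x : 'rV[R]_(\sum_(i < k) n i)%N) :
    lp_norm 2%:E x = lp_norm 2%:E (\row_i lp_norm 2%:E (submxrow x i)).
  apply/eqP; rewrite -(eqrXn2 (n := 2)) ?lp_norm_ge0 //.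
  rewrite [X in _ == X]lp_norm2_sqr lp_norm2_sqr_mulmx -{1 2}[x]submxrowK.
  rewrite tr_mxrow mul_mxrow_mxcol summxE; apply/eqP; apply: eq_bigr => i _.
  by rewrite mxE lp_norm2_sqr_mulmx.
apply: (@banach_mazur_le _ _ _ _ (\mxdiag_i (c i *: P i))
   (\mxdiag_i ((c i)^-1 *: Q i))) => //.
- exact: gauge_lp_sum.
- apply/row_matrixP => j; apply/mxrowP => i.
  rewrite rowE mulmxA !mul_diag -mulmxA -scalemxAl -!scalemxAr scalerA.
  rewrite divff ?gt_eqF // scale1r row1.
  by case: (hab i) => -> *; rewrite mulmx1.
- move=> x; rewrite lp2E; apply: le_trans (hl _); apply: (ler_lp_norm e20) => i.
  have [li0 _ _] := lm i.
  rewrite !mxE mul_diag -scalemxAr (lp_normZ _ _ e20).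
  rewrite !normrM normr_id (gtr0_norm (c0 i)) (gtr0_norm li0).
  rewrite (ger0_norm (lp_norm_ge0 _ _)) (ger0_norm (gauge_ge0 (hN i) _)).
  have [_ [a0 _] ha _ _] := hab i.
  by rewrite -cE -mulrA; exact: (ler_wpM2l (ltW (c0 i)) (ha _)).
move=> x; rewrite [X in _ <= _ * X]lp2E; apply: le_trans (hm _).
apply: (ler_lp_norm p0) => i.
have [_ mi0 _] := lm i.
have ci0 : 0 < (c i)^-1 by rewrite invr_gt0.
rewrite !mxE mul_diag -scalemxAr (gaugeZ (hN i)).
rewrite !normrM normr_id (gtr0_norm ci0) (gtr0_norm mi0).
rewrite (ger0_norm (lp_norm_ge0 _ _)) (ger0_norm (gauge_ge0 (hN i) _)).
have [_ _ _ hb _] := hab i.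
by rewrite -mE -mulrA; exact: (ler_wpM2l (ltW ci0) (hb _)).
Qed.

Lemma banach_mazur_lp_sum_ge (R : realType) (k : nat)
    (n : 'I_k -> nat) (N : forall i : 'I_k, 'rV[R]_(n i) -> R) (p : \bar R) :
  (1 <= p)%E -> (forall i, 0 < n i)%N -> (forall i, gauge (N i)) ->
  lp_norm (bm_exponent p)
      (\row_(i < k) banach_mazur (N i) (@lp_norm R 2%:E (n i))) <=
  banach_mazur (lp_sum p N) (@lp_norm R 2%:E (\sum_(i < k) n i)%N).
Proof.
move=> p1 n0 hN; have p0 : (0 < p)%E by apply: lt_le_trans p1.
have e20 : (0 < 2%:E :> \bar R)%E by rewrite lte_fin.
have r0 : (0 < bm_exponent p)%E.
  by apply: lt_le_trans (bm_exponent_ge2 p1).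
have h2 m := @gauge_lp_norm R 2%:E m e20.
apply: banach_mazur_ge => //; first exact: gauge_lp_sum.
move=> P Q A B PQ A0 B0 hA hB.
have bounds := block_diagonal_bounds p0 hN PQ A0 B0 hA hB.
have inj i (y : 'rV[R]_(n i)) : y *m submxcol P i = 0 -> y = 0.
  (* The family equal to y in block i and 0 elsewhere: its Euclidean side vanishes, so its norm in
     the sum does too. *)
  move=> y0; pose x := @eqtype.dfwith _ (fun j => 'rV[R]_(n j)) (fun=> 0) i y.
  have [_] := bounds x.
  rewrite (_ : \row_j lp_norm _ (x j *m _) = 0); last first.
    apply/rowP => j; rewrite !mxE /x; have [->|ji] := eqVneq j i.
      by rewrite dfwith_in y0 lp_norm0.
    by rewrite dfwith_out 1?eq_sym // mul0mx lp_norm0.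
  rewrite lp_norm0 // mulr0 => xle0.
  have /rowP/(_ i) : \row_j N j (x j) = 0.
    by apply: (lp_norm_eq0 p0); apply/eqP; rewrite eq_le xle0 lp_norm_ge0.
  by rewrite !mxE /x dfwith_in => /(gauge_eq0 (hN i)).
have /fin_all_exists [L hL] : forall i, exists L : 'M[R]_(n i), L \in unitmx /\
    forall x : 'rV[R]_(n i),
      lp_norm 2%:E (x *m L) = lp_norm 2%:E (x *m submxcol P i).
  by move=> i; have [L Lu hL] := square_isometry (inj i); exists L.
pose l : 'rV[R]_k :=
  \row_i op_norm (N i) (@lp_norm R 2%:E (n i)) (mulmxr (L i)).
pose m : 'rV[R]_k :=
  \row_i op_norm (@lp_norm R 2%:E (n i)) (N i) (mulmxr (invmx (L i))).
have l0 i : 0 <= l 0 i by rewrite mxE op_norm_ge0.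
have m0 i : 0 <= m 0 i by rewrite mxE op_norm_ge0.
(* Each L_i competes in the infimum for its block, so d_i <= l_i m_i. *)
apply: (@le_trans _ _ (lp_norm (bm_exponent p) (hadamard l m))).
  apply: (ler_lp_norm r0) => i; rewrite ![in leRHS]mxE !mxE.
  rewrite !ger0_norm ?mulr_ge0 ?op_norm_ge0 //; last first.
    by apply: le_trans (banach_mazur_ge1 _ _ _).
  apply: (@banach_mazur_le _ _ _ _ (L i) (invmx (L i)));
    rewrite ?op_norm_ge0 //.
  - by case: (hL i) => Lu _; rewrite mulmxV.
  - move=> x; exact: (op_normP (mulmxr (L i)) x).
  - move=> x; exact: (op_normP (mulmxr (invmx (L i))) x).
apply: lp_norm_multipliers => // t.
  apply: ler_scaled_lt1 => [|theta t01]; first by rewrite mulr_ge0 ?lp_norm_ge0.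
  (* Vectors x_i of the unit balls on which the L_i nearly attain their norms; the family t_i x_i
     then tests the first block bound. *)
  have /fin_all_exists [x hx] : forall i, exists x, N i x <= 1 /\
      theta * l 0 i <= lp_norm 2%:E (x *m L i).
    move=> i; have [x x1 hx] := op_norm_approx (mulmxr (L i)) (hN i) (h2 _) t01.
    by exists x; rewrite mxE.
  have [h _] := bounds (fun i => t 0 i *: x i).
  case/andP: t01 => /ltW t0 _.
  rewrite -[X in X * _](ger0_norm t0) -(lp_normZ _ _ e20).
  apply: le_trans (le_trans h _).
    apply: (ler_lp_norm e20) => i; rewrite !mxE.
    rewrite -scalemxAl (lp_normZ _ _ e20) -(proj2 (hL i)) !normrM normr_id.
    rewrite (ger0_norm t0) (ger0_norm (lp_norm_ge0 _ _)).
    rewrite (ger0_norm (op_norm_ge0 _ _ _)) //.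
    rewrite mulrA mulrC ler_wpM2l //.
    by have [_] := hx i; rewrite mxE.
  apply: (ler_wpM2l A0); apply: (ler_lp_norm p0) => i.
  rewrite !mxE (gaugeZ (hN i)).
  rewrite normrM normr_id ler_piMr // ger0_norm ?(gauge_ge0 (hN i)) //.
  by case: (hx i).
apply: ler_scaled_lt1 => [|theta t01]; first by rewrite mulr_ge0 ?lp_norm_ge0.
(* The same for the inverses. The test family is t_i y_i L_i^-1, whose i-th Euclidean length is that
   of t_i y_i, hence at most |t_i|. *)
have /fin_all_exists [y hy] : forall i, exists y, lp_norm 2%:E y <= 1 /\
    theta * m 0 i <= N i (y *m invmx (L i)).
  move=> i.
  have [y y1 hy] :=
    op_norm_approx (mulmxr (invmx (L i))) (h2 _) (hN i) t01.
  by exists y; rewrite mxE.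
have [_ h] := bounds (fun i => t 0 i *: (y i *m invmx (L i))).
case/andP: t01 => /ltW t0 _.
rewrite -[X in X * _](ger0_norm t0) -(lp_normZ _ _ p0).
apply: le_trans (le_trans h _).
  apply: (ler_lp_norm p0) => i; rewrite !mxE (gaugeZ (hN i)) !normrM normr_id.
  rewrite (ger0_norm t0) (ger0_norm (gauge_ge0 (hN i) _)).
  rewrite (ger0_norm (op_norm_ge0 _ _ _)) //.
  rewrite mulrA mulrC ler_wpM2l //.
  by have [_] := hy i; rewrite mxE.
apply: (ler_wpM2l B0); apply: (ler_lp_norm e20) => i; rewrite !mxE.
rewrite -scalemxAl (lp_normZ _ _ e20) -(proj2 (hL i)).
rewrite mulmxKV ?(proj1 (hL i)) //.
rewrite normrM normr_id ler_piMr // ger0_norm ?lp_norm_ge0 //.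
by case: (hy i).
Qed.

Theorem theorem1p1 (R : realType) (k : nat) (hk : (0 < k)%N)
    (n : 'I_k -> nat) (hn : forall i : 'I_k, (0 < n i)%N)
    (N : forall i : 'I_k, 'rV[R]_(n i) -> R)
    (hN : forall i : 'I_k, is_norm (N i))
    (p : \bar R) (hp : (1 <= p)%E) :
  (2%:E <= bm_exponent p)%E /\
  banach_mazur (lp_sum p N) (@lp_norm R 2%:E (\sum_(i < k) n i)%N)
  = lp_norm (bm_exponent p)
      (\row_(i < k) banach_mazur (N i) (@lp_norm R 2%:E (n i))).
Proof.
have gN i : gauge (N i) by exact: gauge_is_norm.
split; first exact: bm_exponent_ge2.
apply/eqP; rewrite eq_le banach_mazur_lp_sum_le //=.
exact: banach_mazur_lp_sum_ge.
Qed.
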